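(* Let $A$ be a complex antidiagonal matrix of size $n$ in standard form with entries $a_1,\dots,a_n$, and let $\Lambda=\Lambda(A)$ and $D$ be as defined in the context. The following are equivalent. (a) $A$ is diagonalizable. (b) $\Lambda$ diagonalizes $A$ into a diagonal matrix with a symmetric spectrum for even $n$ and a c-symmetric spectrum for odd $n$. (c) No transpose pair of entries on the antidiagonal of $A$ is defective. (d) $\Lambda$ is (well-defined and) nonsingular. When any of these conditions is met and $D'$ is a diagonalization of $A$ (a diagonal matrix similar to $A$), we have: (i) if $A$ is traceless, then $D'$ is permutation-similar to an antipersymmetric diagonal matrix with the same diagonal elements, including multiplicities; (ii) $A^2$ and $D'^2$ are permutation-similar diagonal matrices. Moreover, when $A$ is diagonalizable, an explicit eigendecomposition is $A=\Lambda D\Lambda^{-1}$.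
   Context: An antidiagonal matrix has nonzero entries only at positions $(i,n+1-i)$. Standard form: for $n=2m$, $A_{m+1-j,\,m+j}=a_{2j-1}$, $A_{m+j,\,m+1-j}=a_{2j}$ ($1\le j\le m$); for $n=2m+1$, $A_{m+1,m+1}=a_1$, $A_{m+1-j,\,m+1+j}=a_{2j+1}$, $A_{m+1+j,\,m+1-j}=a_{2j}$ ($1\le j\le m$). $\sqrt{a_k}$ is a fixed complex square root. A transpose pair is a pair of indexed entries that are reflections of each other across the main diagonal; it is defective if exactly one of the two entries is zero. For $n=2m$: $D=\mathrm{diag}(-\sqrt{a_1}\sqrt{a_2},\sqrt{a_1}\sqrt{a_2},\dots,-\sqrt{a_{n-1}}\sqrt{a_n},\sqrt{a_{n-1}}\sqrt{a_n})$. For $1\le j\le m$, columns $2j-1$ and $2j$ of $\Lambda$ are zero outside rows $m+1-j$ and $m+j$, where (in this order of rows) they equal $\big(-\tfrac{\sqrt{a_{2j-1}}}{\sqrt{a_{2j}}},1\big)$ and $\big(\tfrac{\sqrt{a_{2j-1}}}{\sqrt{a_{2j}}},1\big)$ respectively, except that if $a_{2j-1}=a_{2j}=0$ these two vectors are replaced by any chosen pair of linearly independent vectors of $\mathbb C^2$. For $n=2m+1$: $D=\mathrm{diag}(a_1,-\sqrt{a_2}\sqrt{a_3},\sqrt{a_2}\sqrt{a_3},\dots,-\sqrt{a_{n-1}}\sqrt{a_n},\sqrt{a_{n-1}}\sqrt{a_n})$. Column $1$ of $\Lambda$ has the single nonzero entry $\omega$ in row $m+1$, for any chosen nonzero $\omega\in\mathbb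 C$. For $1\le j\le m$, columns $2j$ and $2j+1$ of $\Lambda$ are zero outside rows $m+1-j$ and $m+1+j$, where they equal $\big(-\tfrac{\sqrt{a_{2j+1}}}{\sqrt{a_{2j}}},1\big)$ and $\big(\tfrac{\sqrt{a_{2j+1}}}{\sqrt{a_{2j}}},1\big)$ respectively, except that if $a_{2j}=a_{2j+1}=0$ these are replaced by any chosen pair of linearly independent vectors of $\mathbb C^2$. $\Lambda$ is undefined when some defective pair has its denominator entry equal to zero. ''$\Lambda$ diagonalizes $A$'' means $\Lambda$ is defined and nonsingular and $\Lambda^{-1}A\Lambda$ is diagonal. A spectrum (multiset of eigenvalues) is symmetric if invariant, with multiplicities, under multiplication by $-1$; for odd size it is c-symmetric if removing one copy of some element $c$ leaves a symmetric multiset. A diagonal matrix $\mathrm{diag}(d_1,\dots,d_n)$ is antipersymmetric if $d_{n+1-i}=-d_i$ for all $i$. Permutation-similar means similar via a permutation matrix. *)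

(* Defs.v *)
From mathcomp Require Import all_boot all_order all_algebra.
From mathcomp Require Import reals.
From mathcomp.real_closed Require Import complex.

Set Implicit Arguments.
Unset Strict Implicit.
Unset Printing Implicit Defensive.

Import Order.TTheory GRing.Theory Num.Theory.

Local Open Scope ring_scope.

(* Row and column numbers, the pair index j and the subscripts of the scalar
   sequences are 1-based; an ordinal p : 'I_n stands for row or column number
   p.+1.  The values of the sequences at subscripts outside 1, ..., n (outside
   1, ..., n./2 for those indexed by pairs) are never used. *)

(* The j-th transpose pair (1 <= j <= n./2) occupies rows m+1-j and m+j when
   n = 2m, and rows m+1-j and m+1+j when n = 2m+1. *)
Definition upper (n j : nat) : nat := ((n./2).+1 - j)%N.
Definition lower (n j : nat) : nat := (n./2 + odd n + j)%N.

(* The subscript of the entry (upper n j, lower n j) is 2j-1 for even n and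
   2j+1 for odd n; that of (lower n j, upper n j) is 2j in both cases. *)
Definition num_idx (n j : nat) : nat := if odd n then j.*2.+1 else j.*2.-1.
Definition den_idx (j : nat) : nat := j.*2.

(* The columns attached to pair j are 2j-1 and 2j for even n, 2j and 2j+1 for
   odd n. *)
Definition pair_of_col (n c : nat) : nat := ((c + ~~ odd n)./2)%N.
Definition second_col (n c : nat) : bool := odd c == odd n.

Definition antidiagonal (F : fieldType) (n : nat) (A : 'M[F]_n) : Prop :=
  forall p q : 'I_n, A p q != 0 -> q = rev_ord p.

Definition standard_form (F : fieldType) (n : nat) (A : 'M[F]_n)
    (a : nat -> F) : Prop :=
  [/\ antidiagonal A,
      forall p : 'I_n, odd n -> p.+1 = (n./2).+1 -> A p p = a 1%N
    & forall (j : nat) (p q : 'I_n), (1 <= j <= n./2)%N ->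
        p.+1 = upper n j -> q.+1 = lower n j ->
        A p q = a (num_idx n j) /\ A q p = a (den_idx j)].

Definition defective (F : fieldType) (x y : F) : bool :=
  (x == 0) != (y == 0).

Definition no_defective_pair (F : fieldType) (n : nat) (A : 'M[F]_n) : Prop :=
  forall p : 'I_n, ~~ defective (A p (rev_ord p)) (A (rev_ord p) p).

(* Entries of the two columns of pair j in rows upper n j and lower n j, in
   this order; s k is the chosen square root of a k, and v j, w j is the pair
   of vectors used when both entries of the pair vanish. *)
Definition Lambda_block (F : fieldType) (n : nat) (a s : nat -> F)
    (v w : nat -> 'cV[F]_2) (j : nat) (second : bool) : F * F :=
  if (a (num_idx n j) == 0) && (a (den_idx j) == 0) then
    let u := if second then w j else v j in (u 0 0, u 1 0)
  else
    let t := s (num_idx n j) / s (den_idx j) in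
    (if second then t else - t, 1).

Definition Lambda_coef (F : fieldType) (n : nat) (a s : nat -> F)
    (v w : nat -> 'cV[F]_2) (om : F) (r c : nat) : F :=
  if odd n && (c == 1%N) then (if r == (n./2).+1 then om else 0)
  else
    let j := pair_of_col n c in
    let b := Lambda_block n a s v w j (second_col n c) in
    if r == upper n j then b.1 else if r == lower n j then b.2 else 0.

Definition Lambda_undefined (F : fieldType) (n : nat) (a : nat -> F) : bool :=
  has (fun j => defective (a (num_idx n j)) (a (den_idx j))
                && (a (den_idx j) == 0))
      (iota 1 n./2).

(* None encodes that the matrix is undefined. *)
Definition Lambda (F : fieldType) (n : nat) (a s : nat -> F)
    (v w : nat -> 'cV[F]_2) (om : F) : option 'M[F]_n :=
  if Lambda_undefined n a then None
  else Some (\matrix_(p, q) Lambda_coef n a s v w om p.+1 q.+1).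

Definition D_coef (F : fieldType) (n : nat) (a s : nat -> F) (c : nat) : F :=
  if odd n && (c == 1%N) then a 1%N
  else
    let j := pair_of_col n c in
    let t := s (num_idx n j) * s (den_idx j) in
    if second_col n c then t else - t.

Definition D_mx (F : fieldType) (n : nat) (a s : nat -> F) : 'M[F]_n :=
  diag_mx (\row_(q < n) D_coef n a s q.+1).

(* S lists the eigenvalues of A with algebraic multiplicities; S is unique up
   to permutation, and exists over an algebraically closed field. *)
Definition is_spectrum (F : fieldType) (n : nat) (A : 'M[F]_n)
    (S : seq F) : Prop :=
  char_poly A = \prod_(z <- S) ('X - z%:P).

Definition symmetric_seq (F : fieldType) (S : seq F) : bool :=
  perm_eq [seq - z | z <- S] S.

Definition symmetric_spectrum (F : fieldType) (n : nat) (A : 'M[F]_n) : Prop :=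
  exists2 S : seq F, is_spectrum A S & symmetric_seq S.

Definition c_symmetric_spectrum (F : fieldType) (n : nat)
    (A : 'M[F]_n) : Prop :=
  exists2 S : seq F, is_spectrum A S
                   & exists2 c : F, c \in S & symmetric_seq (rem c S).

Definition antipersymmetric_diag (F : fieldType) (n : nat)
    (D : 'M[F]_n) : Prop :=
  is_diag_mx D /\ forall p : 'I_n, D (rev_ord p) (rev_ord p) = - D p p.

Definition perm_similar (F : fieldType) (n : nat) (A B : 'M[F]_n) : Prop :=
  exists2 P : 'M[F]_n, is_perm_mx P & B = invmx P *m A *m P.

Definition same_diag_elements (F : fieldType) (n : nat)
    (A B : 'M[F]_n) : Prop :=
  perm_eq [seq A p p | p : 'I_n] [seq B p p | p : 'I_n].

(* Main.v *)
Require Import Defs.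
From mathcomp Require Import all_boot all_order all_fingroup all_algebra.
From mathcomp Require Import reals.
From mathcomp.real_closed Require Import complex.
From mathcomp Require Import zify ring.

Set Implicit Arguments.
Unset Strict Implicit.
Unset Printing Implicit Defensive.

Import Order.TTheory GRing.Theory Num.Theory.

Local Open Scope ring_scope.

(* Each transpose pair (x, y) spans an invariant plane on which A acts as the
   antidiagonal 2x2 matrix with entries x, y.  If x, y are both nonzero its
   eigenvalues are -/+ sqrt x sqrt y with the eigenvectors put in Lambda; if
   both vanish any basis will do.  If exactly one vanishes, A^2 kills a vector
   that A does not, so A is not diagonalizable, and Lambda is undefined or has
   two equal columns.  For the last part, D' and D have the same characteristic
   polynomial, hence the same diagonal up to order, and this diagonal can be
   ordered so that positions i and n+1-i carry the opposite eigenvalues of one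
   transpose pair; their common square is the entry x y of A^2. *)

(** * Similarity and diagonal matrices *)

(** Over the polynomial ring, [P] still intertwines [X - A] and [X - B]; take determinants and
    cancel the nonzero [\det P]. *)
Lemma char_poly_intertwine (F : fieldType) (n : nat) (P A B : 'M[F]_n) :
  P \in unitmx -> P *m A = B *m P -> char_poly A = char_poly B.
Proof.
move=> uP PA; pose Q : 'M[{poly F}]_n := map_mx polyC P.
have detQ : \det Q != 0.
  by rewrite /Q det_map_mx polyC_eq0; move: uP; rewrite unitmxE unitfE.
have PA' : Q *m char_poly_mx A = char_poly_mx B *m Q.
  rewrite /char_poly_mx mulmxBr mulmxBl -!map_mxM PA /=.
  by rewrite -scalar_mxC.
apply: (mulfI detQ).
by rewrite /char_poly -det_mulmx PA' det_mulmx mulrC.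
Qed.

Lemma char_poly_diag (F : fieldType) (n : nat) (X : 'M[F]_n) :
  is_diag_mx X ->
  char_poly X = \prod_(z <- [seq X p p | p : 'I_n]) ('X - z%:P).
Proof.
by move=> /is_diag_mx_is_trig/char_poly_trig->; rewrite big_map big_enum.
Qed.

(** Both diagonals list the roots of one characteristic polynomial, and its factorization into monic
    linear factors is unique up to order. *)
Lemma similar_diag_perm_eq (F : fieldType) (n : nat) (P X Y : 'M[F]_n) :
  P \in unitmx -> P *m X = Y *m P -> is_diag_mx X -> is_diag_mx Y ->
  perm_eq [seq X p p | p : 'I_n] [seq Y p p | p : 'I_n].
Proof.
move=> uP PX dX dY; apply: prod_XsubC_eq.
by rewrite -!char_poly_diag // (char_poly_intertwine uP PX).
Qed.

Lemma perm_similar_diag (F : fieldType) (n : nat) (X Y : 'M[F]_n) :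
  is_diag_mx X -> is_diag_mx Y ->
  perm_eq [seq X p p | p : 'I_n] [seq Y p p | p : 'I_n] -> perm_similar X Y.
Proof.
move=> /is_diag_mxP dX /is_diag_mxP dY; rewrite perm_sym.
move=> /(@tuple_permP _ _ _ [tuple X i i | i < n])[s eqs].
(* Here [s] satisfies [Y i i = X (s i) (s i)]. Conjugating by the matrix of the inverse of [s]
   applies [s] to both row and column indices of [X]. *)
exists (perm_mx s^-1); first exact: perm_mx_is_perm.
have -> : invmx (perm_mx s^-1) = perm_mx s :> 'M[F]_n.
  apply: (can_inj (mulKmx (unitmx_perm F s^-1))).
  by rewrite mulmxV ?unitmx_perm // -perm_mxM mulVg perm_mx1.
rewrite -row_permE -col_permE; apply/matrixP => i j; rewrite !mxE.
have [<-|ij] := eqVneq i j; last first.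
  by rewrite dY ?dX // (inj_eq val_inj) ?(inj_eq perm_inj).
move/(congr1 (fun t => nth 0 t i)): eqs.
rewrite (nth_map i) ?size_enum_ord // nth_ord_enum => ->.
by rewrite -tnth_nth !tnth_mktuple.
Qed.

Lemma perm_eq_image_inj (n : nat) (T : eqType) (g : 'I_n -> 'I_n)
    (f : 'I_n -> T) :
  injective g -> perm_eq [seq f (g p) | p : 'I_n] [seq f p | p : 'I_n].
Proof.
move=> gI; rewrite /image_mem (map_comp f g); apply/perm_map/uniq_perm.
- by rewrite map_inj_uniq ?enum_uniq.
- exact: enum_uniq.
- by move=> p; rewrite mem_enum; apply/mapP; exists (invF gI p);
    rewrite ?mem_enum ?f_invF.
Qed.

(** * Defective pairs obstruct diagonalizability *)

(** In coordinates [v] on a basis of left eigenvectors, the hypothesis reads [v_k d_k^2 = 0], which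
    forces [v_k d_k = 0] in a field. *)
Lemma diagonalizable_ker_sqr (F : fieldType) (n : nat) (A : 'M[F]_n)
    (u : 'rV[F]_n) :
  diagonalizable A -> u *m A *m A = 0 -> u *m A = 0.
Proof.
case=> P uP /similar_diagPex[d /(similarP uP) PA] uAA.
pose v := u *m invmx P; have uE : u = v *m P by rewrite mulmxKV.
have vPA : u *m A = v *m diag_mx d *m P by rewrite uE -!mulmxA PA.
move: uAA; rewrite vPA; suff vdd0 : v *m diag_mx d *m P *m A = 0 ->
  v *m diag_mx d = 0 by move=> /vdd0->; rewrite mul0mx.
rewrite -mulmxA PA mulmxA => /(congr1 (mulmx^~ (invmx P))).
rewrite mulmxK // mul0mx => /rowP vdd; apply/rowP => k.
move: (vdd k); rewrite !mul_mx_diag !mxE => /eqP.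
by rewrite !mulf_eq0 -orbA orbb -mulf_eq0 => /eqP.
Qed.

Lemma mulmx_antidiagonal (F : fieldType) (n : nat) (A B : 'M[F]_n)
    (p q : 'I_n) :
  antidiagonal A -> (A *m B) p q = A p (rev_ord p) * B (rev_ord p) q.
Proof.
move=> antiA; rewrite mxE (bigD1 (rev_ord p)) //= big1 ?addr0 // => k kp.
by have [->|/antiA/eqP] := eqVneq (A p k) 0; rewrite ?mul0r // (negPf kp).
Qed.

(** The unit row vector at [p] is sent by [A] to a multiple of the one at [rev_ord p]. If
    [A (rev_ord p) p = 0], a second application gives 0, so the first already did. Using this at [p]
    and at [rev_ord p] shows that the two entries vanish together. *)
Lemma diagonalizable_no_defective (F : fieldType) (n : nat) (A : 'M[F]_n) :
  antidiagonal A -> diagonalizable A -> no_defective_pair A.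
Proof.
move=> antiA dA.
have half p : A (rev_ord p) p = 0 -> A p (rev_ord p) = 0.
  move=> Arp; have: row p A = 0.
    rewrite rowE; apply: diagonalizable_ker_sqr => //.
    rewrite -mulmxA -rowE; apply/rowP => q;
    rewrite mxE mulmx_antidiagonal // mxE.
    have [->|] := eqVneq (A (rev_ord p) q) 0; first by rewrite mulr0.
    by move=> /[dup] Aq /antiA qp; rewrite qp rev_ordK Arp eqxx in Aq.
  by move/rowP/(_ (rev_ord p)); rewrite !mxE.
move=> p; rewrite /defective negbK; apply/eqP.
apply/idP/idP => /eqP A0; apply/eqP.
  by move: (half (rev_ord p)); rewrite rev_ordK; apply.
exact: half.
Qed.

(** Negation merely swaps the two members of each consecutive couple; induction removes the last
    couple. *)
Lemma symmetric_map_iota (F : fieldType) (f : nat -> F) (k m : nat) :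
  (forall j, (j < m)%N -> f (k + j.*2.+1)%N = - f (k + j.*2)%N) ->
  symmetric_seq [seq f c | c <- iota k m.*2].
Proof.
rewrite /symmetric_seq; elim: m => // m IHm fE.
have -> : m.+1.*2 = (m.*2 + 2)%N by lia.
rewrite iotaD !map_cat perm_cat //=.
  by apply: IHm => j jm; apply: fE; lia.
by rewrite -addnS fE // opprK (perm_catC [:: _] [:: _]).
Qed.

(** * Indexing rows and columns by transpose pairs *)

(** Inverse to [pair_of_col] and [second_col] taken together, away from the central column of odd
    [n]. The predecessor truncates at [j = 0], whence the condition [1 <= j] below. *)
Definition pair_col (n j : nat) (second : bool) : nat :=
  (odd n + j.*2.-1 + second)%N.

Lemma pair_of_pair_col (n j : nat) (second : bool) :
  (1 <= j)%N -> pair_of_col n (pair_col n j second) = j.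
Proof. by rewrite /pair_of_col /pair_col => ?; case: second; lia. Qed.

Lemma second_pair_col (n j : nat) (second : bool) :
  (1 <= j)%N -> second_col n (pair_col n j second) = second.
Proof. by rewrite /second_col /pair_col => ?; case: second; lia. Qed.

Lemma pair_col_center (n j : nat) (second : bool) :
  (1 <= j)%N -> odd n && (pair_col n j second == 1%N) = false.
Proof. by rewrite /pair_col => ?; case: second; lia. Qed.

Lemma pair_col_bounds (n j : nat) (second : bool) :
  (1 <= j <= n./2)%N -> (1 <= pair_col n j second <= n)%N.
Proof. by rewrite /pair_col => ?; case: second; lia. Qed.

Lemma num_idx_bounds (n j : nat) :
  (1 <= j <= n./2)%N -> (1 <= num_idx n j <= n)%N.
Proof. by rewrite /num_idx => ?; case: ifP; lia. Qed.

Lemma den_idx_bounds (n j : nat) :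
  (1 <= j <= n./2)%N -> (1 <= den_idx j <= n)%N.
Proof. by rewrite /den_idx => ?; lia. Qed.

(** With [row_cases], this lets entrywise arguments proceed one transpose pair at a time, the centre
    of odd [n] being treated apart. *)
Lemma col_cases (n c : nat) : (1 <= c <= n)%N ->
  (odd n /\ c = 1%N) \/
  exists j second, (1 <= j <= n./2)%N /\ c = pair_col n j second.
Proof.
rewrite /pair_col => cn.
have [/andP[on /eqP]|nc] := boolP (odd n && (c == 1%N)); [by left | right].
exists (pair_of_col n c), (second_col n c).
rewrite /pair_of_col /second_col; case: eqP => ?; lia.
Qed.

Lemma row_cases (n r : nat) : (1 <= r <= n)%N ->
  (odd n /\ r = n./2.+1) \/
  exists j, (1 <= j <= n./2)%N /\ (r = upper n j \/ r = lower n j).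
Proof.
rewrite /upper /lower => rn.
have [ru|ru] := leqP r n./2; first by right; exists (n./2.+1 - r)%N; lia.
have [/andP[on /eqP]|nr] := boolP (odd n && (r == n./2.+1)); [by left | right].
by exists (r - (n./2 + odd n))%N; lia.
Qed.

(** A bijection from rows to columns which keeps each pair and the centre in place. It serves to
    reorder the diagonal of [D] so that opposite eigenvalues land on rows exchanged by [rev_ord]. *)
Definition col_of_row (n r : nat) : nat :=
  if (r <= n./2)%N then pair_col n (n./2.+1 - r) false
  else if odd n && (r == n./2.+1) then 1%N
  else pair_col n (r - (n./2 + odd n)) true.

Lemma col_of_row_upper (n j : nat) :
  (1 <= j <= n./2)%N -> col_of_row n (upper n j) = pair_col n j false.
Proof.
by rewrite /col_of_row /upper => ?; rewrite ifT; [congr pair_col|]; lia.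
Qed.

Lemma col_of_row_lower (n j : nat) :
  (1 <= j <= n./2)%N -> col_of_row n (lower n j) = pair_col n j true.
Proof.
rewrite /col_of_row /lower => ?; rewrite !ifF; last 2 first.
- by lia.
- by lia.
by congr pair_col; lia.
Qed.

Lemma col_of_row_center (n : nat) : odd n -> col_of_row n n./2.+1 = 1%N.
Proof. by rewrite /col_of_row ltnn eqxx andbT => ->. Qed.

Lemma col_of_row_bounds (n r : nat) :
  (1 <= r <= n)%N -> (1 <= col_of_row n r <= n)%N.
Proof.
move=> /row_cases[[on ->]|[j [jn [->|->]]]].
- by rewrite col_of_row_center //; lia.
- by rewrite col_of_row_upper ?pair_col_bounds.
- by rewrite col_of_row_lower ?pair_col_bounds.
Qed.

Lemma col_of_row_inj (n r1 r2 : nat) : (1 <= r1 <= n)%N -> (1 <= r2 <= n)%N ->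
  col_of_row n r1 = col_of_row n r2 -> r1 = r2.
Proof.
rewrite /col_of_row /pair_col => ? ?.
by do ![case: ifP]; lia.
Qed.

Lemma rev_ord_upper (n j : nat) (p : 'I_n) :
  (1 <= j <= n./2)%N -> ((rev_ord p).+1 == upper n j) = (p.+1 == lower n j).
Proof. by have := ltn_ord p; rewrite /upper /lower /= => ? ?; lia. Qed.

Lemma rev_ord_lower (n j : nat) (p : 'I_n) :
  (1 <= j <= n./2)%N -> ((rev_ord p).+1 == lower n j) = (p.+1 == upper n j).
Proof. by have := ltn_ord p; rewrite /upper /lower /= => ? ?; lia. Qed.

Lemma upper_neq_lower (n j : nat) :
  (1 <= j)%N -> (lower n j == upper n j) = false.
Proof. by rewrite /upper /lower; lia. Qed.

Lemma rev_ord_center (n : nat) (p : 'I_n) :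
  odd n -> p.+1 = n./2.+1 -> rev_ord p = p.
Proof. by move=> ? ?; apply/val_inj => /=; lia. Qed.

(** * Standard form, [D] and [Lambda] read pair by pair *)

Lemma standard_form_pair (F : fieldType) (n : nat) (A : 'M[F]_n)
    (a : nat -> F) (j : nat) (p : 'I_n) :
  standard_form A a -> (1 <= j <= n./2)%N -> p.+1 = upper n j ->
  A p (rev_ord p) = a (num_idx n j) /\ A (rev_ord p) p = a (den_idx j).
Proof.
move=> [_ _ Aa] jn pj; apply: Aa => //.
by apply/eqP; rewrite rev_ord_lower // pj.
Qed.

(** Matrix positions meet each pair twice, in both orders, which is harmless as defectiveness is
    symmetric. The central entry is paired with itself and is never defective. *)
Lemma standard_form_no_defective (F : fieldType) (n : nat) (A : 'M[F]_n)
    (a : nat -> F) : standard_form A a ->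
  no_defective_pair A <->
  forall j, (1 <= j <= n./2)%N ->
    ~~ defective (a (num_idx n j)) (a (den_idx j)).
Proof.
move=> Aa; split=> [ndA j jn|nda p].
  (* Row numbers are 1-based and ordinals 0-based, hence the predecessor. *)
  have lt_n : ((upper n j).-1 < n)%N by rewrite /upper; lia.
  have pE : (Ordinal lt_n).+1 = upper n j by rewrite /= /upper; lia.
  by have [<- <-] := standard_form_pair Aa jn pE.
have [[on pE]|[j [jn [pE|pE]]]] := @row_cases n p.+1 (ltn_ord p).
- by rewrite rev_ord_center // /defective eqxx.
- by have [-> ->] := standard_form_pair Aa jn pE; apply: nda.
have /eqP rpE : (rev_ord p).+1 == upper n j by rewrite rev_ord_upper // pE.
have := standard_form_pair Aa jn rpE; rewrite rev_ordK => -[-> ->].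
by rewrite /defective eq_sym; apply: nda.
Qed.

Lemma D_coef_pair (F : fieldType) (n : nat) (a s : nat -> F) (j : nat)
    (second : bool) : (1 <= j)%N ->
  D_coef n a s (pair_col n j second) =
  (if second then 1 else - 1) * (s (num_idx n j) * s (den_idx j)).
Proof.
move=> j_gt0; rewrite /D_coef pair_col_center // pair_of_pair_col //.
by rewrite second_pair_col //; case: second; rewrite ?mul1r ?mulN1r.
Qed.

Lemma D_coef_center (F : fieldType) (n : nat) (a s : nat -> F) :
  odd n -> D_coef n a s 1 = a 1%N.
Proof. by rewrite /D_coef eqxx andbT => ->. Qed.

Lemma Lambda_coef_pair (F : fieldType) (n : nat) (a s : nat -> F)
    (v w : nat -> 'cV[F]_2) (om : F) (r j : nat) (second : bool) :
  (1 <= j)%N ->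
  Lambda_coef n a s v w om r (pair_col n j second) =
  if r == upper n j then (Lambda_block n a s v w j second).1
  else if r == lower n j then (Lambda_block n a s v w j second).2 else 0.
Proof.
move=> j_gt0; rewrite /Lambda_coef pair_col_center // pair_of_pair_col //.
by rewrite second_pair_col.
Qed.

Lemma Lambda_coef_center (F : fieldType) (n : nat) (a s : nat -> F)
    (v w : nat -> 'cV[F]_2) (om : F) (r : nat) : odd n ->
  Lambda_coef n a s v w om r 1 = if r == n./2.+1 then om else 0.
Proof. by rewrite /Lambda_coef eqxx andbT => ->. Qed.

(** The total matrix behind the option [Lambda], so that products can be stated directly; a quotient
    with zero denominator counts as 0 here. *)
Definition Lambda_mx (F : fieldType) (n : nat) (a s : nat -> F)
    (v w : nat -> 'cV[F]_2) (om : F) : 'M[F]_n :=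
  \matrix_(p, q) Lambda_coef n a s v w om p.+1 q.+1.

Lemma LambdaE (F : fieldType) (n : nat) (a s : nat -> F)
    (v w : nat -> 'cV[F]_2) (om : F) :
  (forall j, (1 <= j <= n./2)%N ->
     ~~ defective (a (num_idx n j)) (a (den_idx j))) ->
  Lambda n a s v w om = Some (Lambda_mx n a s v w om).
Proof.
move=> nda; rewrite /Lambda ifF //; apply/hasPn => j.
by rewrite mem_iota => jn; rewrite (negPf (nda _ _)) //; lia.
Qed.

(** * Nonsingularity of [Lambda] *)

Lemma sum_two (V : nmodType) (I : finType) (i1 i2 : I) (f : I -> V) :
  i2 != i1 -> (forall i, i != i1 -> i != i2 -> f i = 0) ->
  \sum_i f i = f i1 + f i2.
Proof.
move=> i21 f0; rewrite (bigD1 i1) // (bigD1 i2) //= big1 ?addr0 //.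
by move=> i /andP[? ?]; apply: f0.
Qed.

(** Freeness makes [y] nonzero. If the determinant vanished, dividing at a nonzero coordinate of [y]
    would exhibit [x] as a multiple of [y]. *)
Lemma free_pair_det (F : fieldType) (x y : 'cV[F]_2) :
  free [:: x; y] -> x 0 0 * y 1 0 - y 0 0 * x 1 0 != 0.
Proof.
rewrite free_cons seq1_free span_seq1 => /andP[xy y0].
apply: contraNneq xy => /eqP; rewrite subr_eq0 => /eqP det0; apply/vlineP.
have x_eq c : x 0 0 = c * y 0 0 -> x 1 0 = c * y 1 0 -> x = c *: y.
  move=> x0E x1E; apply/colP => -[[|[|//]] lt_i2]; rewrite mxE.
    by rewrite (_ : Ordinal _ = 0) //; apply: val_inj.
  by rewrite (_ : Ordinal _ = 1) //; apply: val_inj.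
have [y00|y00] := eqVneq (y 0 0) 0; last first.
  by exists (x 0 0 / y 0 0); apply: x_eq; [field | field: det0].
have y10 : y 1 0 != 0.
  apply: contraNneq y0 => y10; apply/eqP/colP => -[[|[|//]] lt_i2]; rewrite mxE.
    by rewrite (_ : Ordinal _ = 0) //; apply: val_inj.
  by rewrite (_ : Ordinal _ = 1) //; apply: val_inj.
exists (x 1 0 / y 1 0); apply: x_eq; last by field.
by rewrite y00 mulr0; apply: (mulIf y10); rewrite det0 y00 !mul0r.
Qed.

(** If both entries vanish, the chosen vectors are free. Otherwise both are nonzero, and the columns
    [(-t, 1)] and [(t, 1)] have determinant [-2t] with [t] nonzero. *)
Lemma Lambda_block_det (F : fieldType) (n : nat) (a s : nat -> F)
    (v w : nat -> 'cV[F]_2) (j : nat) : 2%:R != 0 :> F ->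
  (forall k, (1 <= k <= n)%N -> s k ^+ 2 = a k) ->
  (a (num_idx n j) = 0 -> a (den_idx j) = 0 -> free [:: v j; w j]) ->
  (1 <= j <= n./2)%N -> ~~ defective (a (num_idx n j)) (a (den_idx j)) ->
  let b1 := Lambda_block n a s v w j false in
  let b2 := Lambda_block n a s v w j true in
  b1.1 * b2.2 - b2.1 * b1.2 != 0.
Proof.
move=> two_neq0 sqrt_s vw_free jn; rewrite /defective negbK /Lambda_block.
have := sqrt_s _ (num_idx_bounds jn); have := sqrt_s _ (den_idx_bounds jn).
move=> sd sn /eqP nd; have [an0|an_neq0] /= := eqVneq (a (num_idx n j)) 0.
  have /eqP ad0 : a (den_idx j) == 0 by rewrite -nd an0.
  by rewrite ad0 eqxx /=; apply: free_pair_det (vw_free an0 ad0).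
rewrite !mulr1 -opprD oppr_eq0 -mulr2n -mulr_natl mulf_neq0 //.
have sn0 : s (num_idx n j) != 0 by rewrite -sqrf_eq0 sn.
have sd0 : s (den_idx j) != 0 by rewrite -sqrf_eq0 sd -nd.
by rewrite mulf_neq0 ?invr_eq0.
Qed.

(** The left kernel is trivial: the two columns of a pair are supported on its two rows, so
    [u *m L = 0] splits into 2x2 systems with nonzero determinant, plus a scalar equation with
    coefficient [om] at the centre. *)
Lemma Lambda_mx_unit (F : fieldType) (n : nat) (a s : nat -> F)
    (v w : nat -> 'cV[F]_2) (om : F) : om != 0 ->
  (forall j, (1 <= j <= n./2)%N ->
     let b1 := Lambda_block n a s v w j false in
     let b2 := Lambda_block n a s v w j true in
     b1.1 * b2.2 - b2.1 * b1.2 != 0) ->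
  Lambda_mx n a s v w om \in unitmx.
Proof.
move=> om_neq0 det_neq0; rewrite -row_free_unit -kermx_eq0.
set L := Lambda_mx _ _ _ _ _ _.
apply/eqP/row_matrixP => k; rewrite row0.
set u := row k _; have uL : u *m L = 0 by rewrite -row_mul mulmx_ker row0.
have uLq (q : 'I_n) : \sum_p u 0 p * Lambda_coef n a s v w om p.+1 q.+1 = 0.
  have /rowP/(_ q) := uL; rewrite !mxE => uLq0; rewrite -[RHS]uLq0.
  by apply: eq_bigr => p _; rewrite !mxE.
have pair0 j (p1 p2 : 'I_n) : (1 <= j <= n./2)%N ->
    p1.+1 = upper n j -> p2.+1 = lower n j -> u 0 p1 = 0 /\ u 0 p2 = 0.
  move=> jn p1E p2E; have j_gt0 : (1 <= j)%N by lia.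
  have := det_neq0 _ jn; set b1 := Lambda_block _ _ _ _ _ _ false.
  set b2 := Lambda_block _ _ _ _ _ _ true => /= det_b.
  have p21 : p2 != p1.
    apply: contraFneq (upper_neq_lower n j_gt0) => p12.
    by rewrite -p1E -p2E p12.
  have eqn second : let b := Lambda_block n a s v w j second in
      u 0 p1 * b.1 + u 0 p2 * b.2 = 0.
    have col_n := pair_col_bounds second jn.
    have lt_n : ((pair_col n j second).-1 < n)%N by lia.
    have := uLq (Ordinal lt_n); rewrite /= prednK; last by lia.
    rewrite (sum_two p21) => [|p pp1 pp2]; rewrite !Lambda_coef_pair //.
      by rewrite p1E p2E !eqxx upper_neq_lower.
    rewrite -p1E -p2E !eqSS !ifF ?mulr0 //.
      by rewrite (inj_eq val_inj) (negPf pp2).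
    by rewrite (inj_eq val_inj) (negPf pp1).
  have e1 := eqn false; have e2 := eqn true; rewrite /= -/b1 -/b2 in e1 e2.
  (* Cramer's rule: each unknown times the determinant is a combination of the two equations [e1]
     and [e2]. *)
  split; apply: (mulIf det_b); rewrite mul0r.
    transitivity (b2.2 * (u 0 p1 * b1.1 + u 0 p2 * b1.2)
                  - b1.2 * (u 0 p1 * b2.1 + u 0 p2 * b2.2)); first by ring.
    by rewrite e1 e2 !mulr0 subrr.
  transitivity (b1.1 * (u 0 p1 * b2.1 + u 0 p2 * b2.2)
                - b2.1 * (u 0 p1 * b1.1 + u 0 p2 * b1.2)); first by ring.
  by rewrite e1 e2 !mulr0 subrr.
apply/rowP => p; rewrite [RHS]mxE.
have [[on pE]|[j [jn [pE|pE]]]] := @row_cases n p.+1 (ltn_ord p).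
(* Ordinal 0 is column 1, whose only nonzero entry [om] lies in the central row. *)
- have := uLq (Ordinal (odd_gt0 on)); rewrite /= (bigD1 p) //= big1.
    rewrite addr0 Lambda_coef_center // pE eqxx => /eqP.
    by rewrite mulf_eq0 (negPf om_neq0) orbF => /eqP.
  move=> p' p'p; rewrite Lambda_coef_center // -pE eqSS (inj_eq val_inj).
  by rewrite (negPf p'p) mulr0.
- have /eqP rpE : (rev_ord p).+1 == lower n j by rewrite rev_ord_lower // pE.
  by case: (pair0 j p (rev_ord p)).
have /eqP rpE : (rev_ord p).+1 == upper n j by rewrite rev_ord_upper // pE.
by case: (pair0 j (rev_ord p) p).
Qed.

(** A defective pair with zero denominator leaves [Lambda] undefined. With zero numerator instead,
    both columns of the pair are [(0, 1)], so the determinant vanishes. *)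
Lemma Lambda_unit_no_defective (F : fieldType) (n : nat) (a s : nat -> F)
    (v w : nat -> 'cV[F]_2) (om : F) (L : 'M[F]_n) (j : nat) :
  (forall k, (1 <= k <= n)%N -> s k ^+ 2 = a k) ->
  Lambda n a s v w om = Some L -> L \in unitmx ->
  (1 <= j <= n./2)%N -> ~~ defective (a (num_idx n j)) (a (den_idx j)).
Proof.
move=> sqrt_s; rewrite /Lambda; case: ifP => // /negbT/hasPn Ldef [<-{L}] uL jn.
apply/negP => dj; have j_gt0 : (1 <= j)%N by lia.
have ad_neq0 : a (den_idx j) != 0.
  by have := Ldef j; rewrite mem_iota dj /=; apply; lia.
have an0 : a (num_idx n j) = 0.
  by apply/eqP; move: dj; rewrite /defective (negPf ad_neq0) eqbF_neg negbK.
have sn0 : s (num_idx n j) = 0.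
  by apply/eqP; rewrite -sqrf_eq0 sqrt_s ?an0 ?num_idx_bounds.
have blockE second : Lambda_block n a s v w j second = (0, 1).
  by rewrite /Lambda_block (negPf ad_neq0) andbF sn0 mul0r oppr0 if_same.
have lt_n second : ((pair_col n j second).-1 < n)%N.
  by have := pair_col_bounds second jn; lia.
have ltE second : (Ordinal (lt_n second)).+1 = pair_col n j second.
  by have := pair_col_bounds second jn; rewrite /=; lia.
(* Transposing turns the equal columns into the equal rows expected by [determinant_alternate]. *)
move: uL; rewrite -unitmx_tr unitmxE unitfE => /eqP; apply.
apply: (@determinant_alternate _ _ _ (Ordinal (lt_n false))
          (Ordinal (lt_n true))).
  by rewrite -val_eqE /= /pair_col; lia.
by move=> p; rewrite !mxE !ltE !Lambda_coef_pair // !blockE.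
Qed.

(** * The eigenvector equation *)

(** With [x], [y] the two square roots of a pair and [e] a sign, the block sends [(e x/y, 1)] to
    [(x^2, e x y)], which is [e x y] times the vector. If [x] and [y] vanish, both sides are 0
    whatever vectors were chosen. *)
Lemma mulmx_Lambda (F : fieldType) (n : nat) (A : 'M[F]_n) (a s : nat -> F)
    (v w : nat -> 'cV[F]_2) (om : F) :
  standard_form A a -> (forall k, (1 <= k <= n)%N -> s k ^+ 2 = a k) ->
  (forall j, (1 <= j <= n./2)%N ->
     ~~ defective (a (num_idx n j)) (a (den_idx j))) ->
  A *m Lambda_mx n a s v w om = Lambda_mx n a s v w om *m D_mx n a s.
Proof.
move=> Aa sqrt_s nda; have [antiA Amid _] := Aa; apply/matrixP => p q.
rewrite mulmx_antidiagonal // mul_mx_diag !mxE.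
have [[on ->]|[j [second [jn ->]]]] := @col_cases n q.+1 (ltn_ord q).
  rewrite D_coef_center // !Lambda_coef_center //.
  have [pE|pE] := eqVneq p.+1 n./2.+1.
    by rewrite rev_ord_center // pE eqxx Amid // mulrC.
  by rewrite ifF ?mulr0 ?mul0r //; have := ltn_ord p; rewrite /=; lia.
have j_gt0 : (1 <= j)%N by lia.
rewrite D_coef_pair // !Lambda_coef_pair // rev_ord_upper // rev_ord_lower //.
have [an ad] : a (num_idx n j) * (Lambda_block n a s v w j second).2 =
      (Lambda_block n a s v w j second).1 *
      ((if second then 1 else -1) * (s (num_idx n j) * s (den_idx j))) /\
    a (den_idx j) * (Lambda_block n a s v w j second).1 =
      (Lambda_block n a s v w j second).2 *
      ((if second then 1 else -1) * (s (num_idx n j) * s (den_idx j))).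
  move: (nda _ jn); rewrite /defective negbK /Lambda_block.
  rewrite -!sqrt_s ?num_idx_bounds ?den_idx_bounds // !sqrf_eq0.
  set x := s _; set y := s _; have [->|x0] := eqVneq x 0.
    rewrite eq_sym eqb_id => /eqP->.
    by split; rewrite !(expr0n, mul0r, mulr0) //=.
  rewrite eq_sym eqbF_neg => y0 /=.
  by split; case: second; field.
have [pE|pE] := eqVneq p.+1 (upper n j).
  have [Anum _] := standard_form_pair Aa jn pE.
  by rewrite pE eq_sym upper_neq_lower // Anum.
have [pE'|pE'] := eqVneq p.+1 (lower n j); last by rewrite mulr0 mul0r.
have /eqP rpE : (rev_ord p).+1 == upper n j by rewrite rev_ord_upper // pE'.
by have [_] := standard_form_pair Aa jn rpE; rewrite rev_ordK => ->.
Qed.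

(** * Symmetry of the spectrum, and the diagonal of [D] reordered by rows *)

Lemma D_spectrum (F : fieldType) (n : nat) (a s : nat -> F) :
  is_spectrum (D_mx n a s) [seq D_coef n a s c | c <- iota 1 n].
Proof.
rewrite /is_spectrum char_poly_diag ?diag_mx_is_diag //; congr bigop.
have -> : iota 1 n = [seq (val p).+1 | p <- enum 'I_n].
  by rewrite (map_comp succn val) val_enum_ord -[1%N]addn0 iotaDl.
by rewrite -map_comp; apply: eq_map => p; rewrite !mxE eqxx mulr1n.
Qed.

(** Starting at [(odd n).+1] skips the central eigenvalue of odd [n]; the remaining columns form
    consecutive couples with opposite entries. *)
Lemma D_symmetric_pairs (F : fieldType) (n : nat) (a s : nat -> F) :
  symmetric_seq [seq D_coef n a s c | c <- iota (odd n).+1 n./2.*2].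
Proof.
apply: symmetric_map_iota => j jn.
have pairE (second : bool) :
    ((odd n).+1 + j.*2 + second)%N = pair_col n j.+1 second.
  by rewrite /pair_col; lia.
have := pairE true; rewrite addn1 -addnS => ->.
have := pairE false; rewrite addn0 => ->.
by rewrite !D_coef_pair // mulN1r opprK mul1r.
Qed.

Lemma D_symmetric_spectrum (F : fieldType) (n : nat) (a s : nat -> F) :
  if odd n then c_symmetric_spectrum (D_mx n a s)
  else symmetric_spectrum (D_mx n a s).
Proof.
have Dsym := D_symmetric_pairs n a s; have Dsp := D_spectrum n a s.
have: iota 1 n = iota 1 (odd n + n./2.*2) by rewrite odd_double_half.
rewrite iotaD add1n => iE.
case: ifP => on; rewrite on /= in Dsym iE; last first.
  by exists [seq D_coef n a s c | c <- iota 1 n] => //; rewrite iE.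
(* The eigenvalue of column 1 heads the list, so [rem] removes exactly that one and leaves the
   couples. *)
exists [seq D_coef n a s c | c <- iota 1 n] => //; exists (D_coef n a s 1).
  by rewrite iE mem_head.
by rewrite iE /= eqxx.
Qed.

(* The diagonal of D, reordered so that the two eigenvalues of a transpose pair
   sit in the rows of that pair. *)
Definition D_row (F : fieldType) (n : nat) (a s : nat -> F) (p : 'I_n) : F :=
  D_coef n a s (col_of_row n p.+1).

(** [col_of_row] is injective on a finite set of indices, hence permutes them. *)
Lemma D_row_perm_eq (F : fieldType) (n : nat) (a s : nat -> F) :
  perm_eq [seq D_row a s p | p : 'I_n] [seq D_mx n a s p p | p : 'I_n].
Proof.
have lt_n (p : 'I_n) : ((col_of_row n p.+1).-1 < n)%N.
  by have := @col_of_row_bounds n p.+1 (ltn_ord p); lia.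
have colE (p : 'I_n) : (Ordinal (lt_n p)).+1 = col_of_row n p.+1.
  by have := @col_of_row_bounds n p.+1 (ltn_ord p); rewrite /=; lia.
have inj_col : injective (fun p => Ordinal (lt_n p)).
  move=> p1 p2 /(congr1 (fun p : 'I_n => p.+1)); rewrite !colE.
  move=> /(@col_of_row_inj n p1.+1 p2.+1 (ltn_ord p1) (ltn_ord p2)) [].
  exact: val_inj.
have := perm_eq_image_inj (fun p : 'I_n => D_coef n a s p.+1) inj_col.
congr perm_eq; apply: eq_map => p; first by rewrite colE.
by rewrite !mxE eqxx mulr1n.
Qed.

(** [rev_ord] exchanges the two rows of a pair, which carry opposite eigenvalues. It fixes the
    central row, where the entry must therefore be 0. *)
Lemma D_row_rev (F : fieldType) (n : nat) (a s : nat -> F) (p : 'I_n) :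
  (odd n -> a 1%N = 0) -> D_row a s (rev_ord p) = - D_row a s p.
Proof.
move=> a1; rewrite /D_row.
have [[on pE]|[j [jn [pE|pE]]]] := @row_cases n p.+1 (ltn_ord p).
- rewrite rev_ord_center // pE col_of_row_center // D_coef_center // a1 //.
  by rewrite oppr0.
- have /eqP -> : (rev_ord p).+1 == lower n j by rewrite rev_ord_lower // pE.
  rewrite pE col_of_row_upper // col_of_row_lower // !D_coef_pair; try lia.
  by rewrite mul1r mulN1r opprK.
have /eqP -> : (rev_ord p).+1 == upper n j by rewrite rev_ord_upper // pE.
rewrite pE col_of_row_upper // col_of_row_lower // !D_coef_pair; try lia.
by rewrite mul1r mulN1r.
Qed.

Lemma D_row_sqr (F : fieldType) (n : nat) (A : 'M[F]_n) (a s : nat -> F)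
    (p : 'I_n) :
  standard_form A a -> (forall k, (1 <= k <= n)%N -> s k ^+ 2 = a k) ->
  A p (rev_ord p) * A (rev_ord p) p = D_row a s p ^+ 2.
Proof.
move=> Aa sqrt_s; have [_ Amid _] := Aa; rewrite /D_row.
have [[on pE]|[j [jn [pE|pE]]]] := @row_cases n p.+1 (ltn_ord p).
- by rewrite rev_ord_center // pE col_of_row_center // D_coef_center // Amid.
- have [-> ->] := standard_form_pair Aa jn pE.
  rewrite pE col_of_row_upper // D_coef_pair; last by lia.
  by rewrite -!sqrt_s ?num_idx_bounds ?den_idx_bounds //; ring.
have /eqP rpE : (rev_ord p).+1 == upper n j by rewrite rev_ord_upper // pE.
have := standard_form_pair Aa jn rpE; rewrite rev_ordK => -[-> ->].
rewrite pE col_of_row_lower // D_coef_pair; last by lia.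
by rewrite -!sqrt_s ?num_idx_bounds ?den_idx_bounds //; ring.
Qed.

(** Only the central index is its own reflection, so every other diagonal entry is 0. This turns
    tracelessness into the hypothesis of [D_row_rev]. *)
Lemma mxtrace_standard_form (F : fieldType) (n : nat) (A : 'M[F]_n)
    (a : nat -> F) : standard_form A a -> odd n -> \tr A = a 1%N.
Proof.
move=> [antiA Amid _] on; have lt_n : (n./2 < n)%N by lia.
rewrite /mxtrace (bigD1 (Ordinal lt_n)) //= Amid // big1 ?addr0 // => p pm.
have [//|/antiA pp] := eqVneq (A p p) 0.
case/eqP: pm; apply: val_inj => /=; move: (congr1 val pp) => /=.
by have := ltn_ord p; lia.
Qed.

Theorem theorem5p5 (R : realType) (n : nat) (A : 'M[R[i]]_n)
    (a s : nat -> R[i]) (v w : nat -> 'cV[R[i]]_2) (om : R[i])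
    (A_std : standard_form A a)
    (s_sqrt : forall k : nat, (1 <= k <= n)%N -> s k ^+ 2 = a k)
    (vw_free : forall j : nat, (1 <= j <= n./2)%N ->
       a (num_idx n j) = 0 -> a (den_idx j) = 0 -> free [:: v j; w j])
    (om_neq0 : om != 0) :
  [/\ [<-> diagonalizable A;
           exists L : 'M[R[i]]_n,
             [/\ Lambda n a s v w om = Some L,
                 L \in unitmx,
                 is_diag_mx (invmx L *m A *m L)
               & if odd n then c_symmetric_spectrum (invmx L *m A *m L)
                 else symmetric_spectrum (invmx L *m A *m L)];
           no_defective_pair A;
           exists2 L : 'M[R[i]]_n,
             Lambda n a s v w om = Some L & L \in unitmx],
      diagonalizable A ->
        forall D' : 'M[R[i]]_n, is_diag_mx D' -> similar_in unitmx A D' ->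
          (\tr A = 0 ->
             exists D'' : 'M[R[i]]_n,
               [/\ antipersymmetric_diag D'', perm_similar D' D''
                 & same_diag_elements D' D''])
          /\ [/\ is_diag_mx (A *m A), is_diag_mx (D' *m D')
               & perm_similar (A *m A) (D' *m D')]
    & diagonalizable A ->
        exists L : 'M[R[i]]_n,
          [/\ Lambda n a s v w om = Some L, L \in unitmx
            & A = L *m D_mx n a s *m invmx L]].

Proof.
have two_neq0 : 2%:R != 0 :> R[i] by rewrite pnatr_eq0.
have [antiA _ _] := A_std.
have LE := @LambdaE _ n a s v w om.
have uL : (forall j, (1 <= j <= n./2)%N ->
    ~~ defective (a (num_idx n j)) (a (den_idx j))) ->
    Lambda_mx n a s v w om \in unitmx.
  move=> nda; apply: Lambda_mx_unit => // j jn.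
  by apply: Lambda_block_det => //; [exact: vw_free | exact: nda].
have a_c : diagonalizable A -> no_defective_pair A.
  exact: diagonalizable_no_defective.
have c_nda := standard_form_no_defective A_std.
have AL := mulmx_Lambda v w om A_std s_sqrt.
have diagLA : (forall j, (1 <= j <= n./2)%N ->
    ~~ defective (a (num_idx n j)) (a (den_idx j))) ->
    invmx (Lambda_mx n a s v w om) *m A *m Lambda_mx n a s v w om = D_mx n a s.
  by move=> nda; rewrite -mulmxA AL // mulKmx // uL.
have dD : is_diag_mx (D_mx n a s) by exact: diag_mx_is_diag.
split.
- tfae.
  + move=> /a_c/c_nda nda; exists (Lambda_mx n a s v w om).
    rewrite LE // uL // diagLA //; split=> //; exact: D_symmetric_spectrum.
  (* [diagonalizable] conjugates as [P *m A *m invmx P], so its witness is the inverse of [L]. *)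
  + move=> [L [_ uL' dL _]]; apply: a_c; exists (invmx L).
      by rewrite unitmx_inv.
    by rewrite /similar_to conjVmx.
  + by move=> /c_nda nda; exists (Lambda_mx n a s v w om); rewrite ?LE ?uL.
  + move=> [L LE' uL'].
    have nda j (jn : (1 <= j <= n./2)%N) :=
      Lambda_unit_no_defective s_sqrt LE' uL' jn.
    exists (invmx (Lambda_mx n a s v w om)); first by rewrite unitmx_inv uL.
    by rewrite /similar_to conjVmx ?uL // diagLA.
- move=> /a_c/c_nda nda D' dD' [P uP /(similarP uP) PA].
  set L := Lambda_mx n a s v w om in LE uL AL diagLA.
  have D'D : perm_eq [seq D_row a s p | p : 'I_n] [seq D' p p | p : 'I_n].
    apply: perm_trans (D_row_perm_eq n a s) _.
    (* [P] carries [A] to [D'] and [L] carries [D] to [A], so [P *m L] intertwines [D] and [D']. *)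
    apply: (similar_diag_perm_eq (P := P *m L)) => //.
      by rewrite unitmx_mul uP uL.
    by rewrite -mulmxA -AL // !mulmxA PA.
  split=> [trA|].
    pose D'' := diag_mx (\row_(p < n) D_row a s p).
    have D''E p : D'' p p = D_row a s p by rewrite !mxE eqxx mulr1n.
    have D'D'' : perm_eq [seq D' p p | p : 'I_n] [seq D'' p p | p : 'I_n].
      by rewrite perm_sym /image_mem (eq_map D''E).
    have dD'' : is_diag_mx D'' by apply: diag_mx_is_diag.
    exists D''; split; [split=> [|p] | exact: perm_similar_diag | exact: D'D''].
      exact: dD''.
    rewrite !D''E D_row_rev // => on.
    by rewrite -(mxtrace_standard_form A_std on).
  (* Reflecting an index twice returns it, so the square is diagonal. *)
  have AAE p q : (A *m A) p q = if p == q then D_row a s p ^+ 2 else 0.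
    rewrite mulmx_antidiagonal //; case: eqVneq => [<-|pq].
      exact: D_row_sqr.
    have [->|/antiA] := eqVneq (A (rev_ord p) q) 0; first by rewrite mulr0.
    by rewrite rev_ordK => qp; rewrite qp eqxx in pq.
  have dAA : is_diag_mx (A *m A).
    by apply/is_diag_mxP => p q pq; rewrite AAE -val_eqE (negPf pq).
  have /diag_mxP[d' D'E] := dD'.
  have dDD : is_diag_mx (D' *m D') by rewrite D'E mulmx_diag diag_mx_is_diag.
  split=> //; apply: perm_similar_diag => //.
  have sqrE (f : 'I_n -> R[i]) :
      [seq z ^+ 2 | z <- [seq f p | p : 'I_n]] = [seq f p ^+ 2 | p : 'I_n].
    exact: (esym (map_comp (fun z => z ^+ 2) f (enum 'I_n))).
  (* Squaring the two permuted diagonals termwise yields those of [A *m A] and [D' *m D']. *)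
  have := perm_map (fun z => z ^+ 2) D'D; rewrite !sqrE.
  congr perm_eq; apply: eq_map => p; first by rewrite AAE eqxx.
  by rewrite D'E mulmx_diag !mxE eqxx !mulr1n.
move=> /a_c/c_nda nda; exists (Lambda_mx n a s v w om).
by rewrite LE // uL // -AL // mulmxK // uL.
Qed.
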